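(* Let $\mathcal{H}=(V,\mathcal{E})$ be a hypergraph with $n$ vertices, $N=n^3+n^2$, and let $T_0,\dots,T_N$ be the remaining-duration functions of the structured fractional transversal game on $\mathcal{H}$ defined in the context. Each function $T_j(\vec x,r)$ for $0\le j\le N$ is a piecewise linear continuous function with finitely many linear pieces defined on $[0,1]^{\mathcal{E}}\times[0,1]$. Moreover, all $T_j$ are rational in the sense that each linear piece has rational coefficients and rational constant part. As a consequence, the boundaries between regions of the domain with different linear functions can be described by rational equations.
   Context: A hypergraph $\mathcal{H}=(V,\mathcal{E})$ has a finite vertex set $V=\{v_1,\dots,v_n\}$ and an edge set $\mathcal{E}\subseteq 2^V\setminus\{\emptyset\}$. ''Linear'' pieces may have a constant term (i.e. are affine). The structured game has $n$ moves, alternating between Edge-hitter and Staller (with a fixed starting player). Each move consists of $n+1$ rounds, and each round consists of $n$ submoves, dedicated to $v_1,\dots,v_n$ in this order. So there are $N=n(n^2+n)$ submoves, numbered $1,\dots,N$. In the first $n$ rounds of a move, the submove for $v_i$ is a free submove of the player whose move it is (type $H_i$ for Edge-hitter, $S_i$ for Staller); in the last round of a move, the submove for $v_i$ is a greedy submove (type $G_i$). Each move has a total budget of weight $1$; a submove with weight $w$ for $v_i$ increases the cover value of $v_i$ by $w$. For a load vector $\vec x=(x_E)_{E\in\mathcal{E}}\in[0,1]^{\mathcal{E}}$ and available budget $r\in[0,1]$ put $$w_i^{\max}(\vec x,r)=\min\{r,\max\{1-x_E\mid E\ni v_i\}\}$$ (with the inner maximum equal to $0$ if $v_i$ lies in no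 edge), and let $\mathrm{update}_i(\vec x,w)=\vec x\,'$ with $x'_E=x_E$ if $v_i\notin E$ and $x'_E=\min\{1,x_E+w\}$ if $v_i\in E$. $T_j(\vec x,r)$ is the remaining duration (total weight still to be spent) under optimal play when the first $j$ submoves have been made, the current load vector is $\vec x$, and the remaining budget of the current move is $r$ (Edge-hitter minimizes, Staller maximizes the duration; the play necessarily ends after submove $N$). It is given by the backward recursion: $T_N(\vec x,r)=0$, and for $1\le j\le N$, depending on the type of the $j$-th submove: - type $H_i$: $T_{j-1}(\vec x,r)=\min\{w+T_j(\mathrm{update}_i(\vec x,w),r-w)\mid 0\le w\le w_i^{\max}(\vec x,r)\}$; - type $S_i$: the same with $\min$ replaced by $\max$; - type $G_i$, $j$ not a multiple of $n^2+n$: $T_{j-1}(\vec x,r)=w_i^{\max}(\vec x,r)+T_j(\mathrm{update}_i(\vec x,w_i^{\max}(\vec x,r)),\,r-w_i^{\max}(\vec x,r))$; - $j$ a multiple of $n^2+n$ (last greedy submove $G_n$ of a move, after which the budget is reset to $1$): $T_{j-1}(\vec x,r)=w_n^{\max}(\vec x,r)+T_j(\mathrm{update}_n(\vec x,w_n^{\max}(\vec x,r)),\,1)$. *)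

(* Defs.v *)
From HB Require Import structures.
From mathcomp Require Import all_boot all_order all_algebra.
From mathcomp Require Import all_classical all_reals all_analysis.

Set Implicit Arguments.
Unset Strict Implicit.
Unset Printing Implicit Defensive.

Import Order.TTheory GRing.Theory Num.Theory.
Import numFieldNormedType.Exports.

Local Open Scope classical_set_scope.
Local Open Scope ring_scope.

Record hypergraph (n : nat) := Hypergraph {
  edges : {set {set 'I_n}};
  edges_nonempty : finset.set0 \notin edges
}.

Definition edge (n : nat) (H : hypergraph n) : finType :=
  {E : {set 'I_n} | E \in edges H}.

(* The coordinate of the load vector at the edge [e] is stored at position
   [enum_rank e] of a row vector, which gives R^edges its usual topology. *)
Notation load R H := 'rV[R]_#|edge H|.

Definition load_at (R : realType) (n : nat) (H : hypergraph n)
  (x : load R H) (e : edge H) : R := x ord0 (enum_rank e).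

(* A pair (load vector, remaining budget of the current move). *)
Notation state R H := ('rV[R]_#|edge H| * R)%type.

Definition domain (R : realType) (n : nat) (H : hypergraph n)
  : set (state R H) :=
  [set p | (forall e : edge H, 0 <= load_at p.1 e <= 1) /\ 0 <= p.2 <= 1].
Arguments domain R {n} H.

(* On [0,1]-valued loads all the terms 1 - x_E are nonnegative, so the neutral
   element 0 only matters when no edge contains [i]. *)
Definition wmax (R : realType) (n : nat) (H : hypergraph n)
  (i : 'I_n) (x : load R H) (r : R) : R :=
  Num.min r (\big[Num.max/0]_(e : edge H | i \in val e) (1 - load_at x e)).

Definition update (R : realType) (n : nat) (H : hypergraph n)
  (i : 'I_n) (x : load R H) (w : R) : load R H :=
  \row_k (if i \in val (enum_val k : edge H)
          then Num.min 1 (x ord0 k + w) else x ord0 k).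

Inductive player := EdgeHitter | Staller.

Definition opponent (p : player) : player :=
  if p is EdgeHitter then Staller else EdgeHitter.

(* Moves are numbered from 0, move 0 being played by [first]. *)
Definition mover (first : player) (m : nat) : player :=
  if odd m then opponent first else first.

Definition is_optimum (R : realType) (p : player) (A : set R) (v : R) : Prop :=
  A v /\ (if p is EdgeHitter then lbound A v else ubound A v).

(* [Tj] is T_j and the result is the set of durations available in T_{j-1}
   at a free submove for [i]. *)
Definition free_outcomes (R : realType) (n : nat) (H : hypergraph n)
  (i : 'I_n) (Tj : state R H -> R) (x : load R H) (r : R) : set R :=
  [set w + Tj (update i x w, r - w) | w in [set w | 0 <= w <= wmax i x r]].

Definition num_submoves (n : nat) : nat := (n * (n ^ 2 + n))%N.

(* With moves, rounds and vertices all numbered from 0, the submove for the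
   vertex [i] in round [t] of move [m] is the one with number [j] below;
   rounds t < n are free and round t = n is greedy. *)
Definition remaining_duration (R : realType) (n : nat) (H : hypergraph n)
  (first : player) (T : nat -> state R H -> R) : Prop :=
  (forall (x : load R H) (r : R), domain R H (x, r) ->
     T (num_submoves n) (x, r) = 0) /\
  (forall (m : 'I_n) (t : 'I_n.+1) (i : 'I_n) (x : load R H) (r : R),
     domain R H (x, r) ->
     let j := (m * (n ^ 2 + n) + t * n + i).+1 in
     let w := wmax i x r in
     if (t < n)%N then
       is_optimum (mover first m) (free_outcomes i (T j) x r) (T j.-1 (x, r))
     else if (n ^ 2 + n %| j)%N then
       T j.-1 (x, r) = w + T j (update i x w, 1)
     else
       T j.-1 (x, r) = w + T j (update i x w, r - w)).

(* ((c, d), k) stands for the function (x, r) |-> sum_E c_E x_E + d r + k. *)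
Notation rat_affine H := ('rV[rat]_#|edge H| * rat * rat)%type.

Definition affine_eval (R : realType) (n : nat) (H : hypergraph n)
  (a : rat_affine H) (p : state R H) : R :=
  \sum_k ratr (a.1.1 ord0 k) * p.1 ord0 k + ratr a.1.2 * p.2 + ratr a.2.

Definition rat_polyhedron (R : realType) (n : nat) (H : hypergraph n)
  (c : seq (rat_affine H)) : set (state R H) :=
  [set p | forall h, h \in c -> 0 <= affine_eval h p].

(* A piece is a rational polyhedron, given by its defining inequalities,
   together with a rational affine function. *)
Notation rat_piece H := (seq (rat_affine H) * rat_affine H)%type.

Definition piecewise_by (R : realType) (n : nat) (H : hypergraph n)
  (f : state R H -> R) (pieces : seq (rat_piece H)) : Prop :=
  (forall p : state R H, domain R H p ->
     exists2 q : rat_piece H, q \in pieces & rat_polyhedron q.1 p) /\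
  (forall (q : rat_piece H) (p : state R H), q \in pieces ->
     domain R H p -> rat_polyhedron q.1 p ->
     f p = affine_eval q.2 p).

(* Several pieces may carry the same affine function; [region pieces a] is the
   whole part of the domain on which [a] is used. *)
Definition region (R : realType) (n : nat) (H : hypergraph n)
  (pieces : seq (rat_piece H)) (a : rat_affine H) : set (state R H) :=
  [set p | domain R H p /\
     exists2 q : rat_piece H, q \in pieces & q.2 = a /\ rat_polyhedron q.1 p].

Definition boundary (R : realType) (n : nat) (H : hypergraph n)
  (pieces : seq (rat_piece H)) (a b : rat_affine H) : set (state R H) :=
  closure (region pieces a) `&` closure (region pieces b).

(* The boundary between the regions of two different affine functions [a] and
   [b] lies on the rational hyperplane a = b (which is empty if a - b is
   constant), and is the part of it, within the domain, that is cut out by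
   finitely many systems of rational inequalities. *)
Definition rational_boundaries (R : realType) (n : nat) (H : hypergraph n)
  (pieces : seq (rat_piece H)) : Prop :=
  forall a b : rat_affine H,
    a \in map snd pieces -> b \in map snd pieces -> a != b ->
    exists cs : seq (seq (rat_affine H)),
      boundary pieces a b =
      [set p : state R H | [/\ domain R H p, affine_eval a p = affine_eval b p &
         exists2 c, c \in cs & rat_polyhedron c p]].
Arguments rational_boundaries R {n H} pieces.

(* Main.v *)
Require Import Defs.
From HB Require Import structures.
From mathcomp Require Import all_boot all_order all_algebra.
From mathcomp Require Import all_classical all_reals all_analysis.
From mathcomp Require Import ring lra zify.

Set Implicit Arguments.
Unset Strict Implicit.
Unset Printing Implicit Defensive.

Import Order.TTheory GRing.Theory Num.Theory.
Import numFieldNormedType.Exports.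

Local Open Scope classical_set_scope.
Local Open Scope ring_scope.

(** The durations form a class of functions that can be written down with the
    rationals, the coordinates of the state, sums, rational multiples and
    maxima: each of them is the value of a term of type [pl_term] over these
    coordinates. Such a function is visibly continuous, and unfolding the maxima
    into their cases turns a term into finitely many pieces, each a rational
    affine function on a rational polyhedron ([term_pieces_cover],
    [eval_piece]).

    The class is stable under the backward recursion. Greedy submoves only
    substitute terms into a term. For a free submove one optimizes, over [w] in
    the interval from 0 to [wmax], the value of a term in the state and [w].
    For a fixed state, [w] lies in some piece of this term; inside that piece
    the value is affine in [w], so sliding [w] in the favourable direction does
    not hurt until [w] hits an end of the interval or the hyperplane of some
    inequality of the piece. The points where these hyperplanes are hit are
    rational affine functions of the state, and there are finitely many of
    them. Clamped to the interval they are feasible choices, so the optimum is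
    attained, and it is the finite minimum or maximum of the term with these
    candidates substituted for [w] ([exists_candidate], [optimum_termP]).

    Hence the recursion is computed by terms, step by step
    ([backward_termP]). Read in one direction this yields a solution, read in
    the other it shows that every solution agrees with the terms on the domain
    ([remaining_duration_exists], [remaining_duration_term]).

    The boundaries come for free: the domain and the rational polyhedra are
    closed, so regions are closed, the boundary between the regions of [a] and
    [b] is their intersection, and there [a] and [b] both equal the duration
    ([rational_boundaries_of_piecewise]). *)

(** * Rational lattice-linear terms *)

Inductive pl_term (I : Type) :=
| Const of rat
| Var of I
| Add of pl_term I & pl_term I
| Scale of rat & pl_term I
| Max of pl_term I & pl_term I.
Arguments Const {I}.

Fixpoint eval (R : realType) (I : Type) (v : I -> R) (t : pl_term I) : R :=
  match t with
  | Const q => ratr q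
  | Var i => v i
  | Add t1 t2 => eval v t1 + eval v t2
  | Scale q t1 => ratr q * eval v t1
  | Max t1 t2 => Num.max (eval v t1) (eval v t2)
  end.

Fixpoint subst (I J : Type) (s : I -> pl_term J) (t : pl_term I) : pl_term J :=
  match t with
  | Const q => Const q
  | Var i => s i
  | Add t1 t2 => Add (subst s t1) (subst s t2)
  | Scale q t1 => Scale q (subst s t1)
  | Max t1 t2 => Max (subst s t1) (subst s t2)
  end.

Definition Min (I : Type) (t1 t2 : pl_term I) : pl_term I :=
  Scale (-1) (Max (Scale (-1) t1) (Scale (-1) t2)).

Definition Diff (I : Type) (t1 t2 : pl_term I) : pl_term I :=
  Add t1 (Scale (-1) t2).

Section Eval.
Variables (R : realType) (I : Type).
Implicit Types (v : I -> R) (t : pl_term I).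

Lemma eq_eval v v' t : v =1 v' -> eval v t = eval v' t.
Proof. by move=> e; elim: t => //= [t1 -> t2 ->|q t1 ->|t1 -> t2 ->]. Qed.

Lemma eval_subst (J : Type) (s : J -> pl_term I) v (t : pl_term J) :
  eval v (subst s t) = eval (fun j => eval v (s j)) t.
Proof. by elim: t => //= [t1 -> t2 ->|q t1 ->|t1 -> t2 ->]. Qed.

Lemma eval_Min v t1 t2 :
  eval v (Min t1 t2) = Num.min (eval v t1) (eval v t2).
Proof. by rewrite /= rmorphN1 !mulN1r oppr_max !opprK. Qed.

Lemma eval_Diff v t1 t2 : eval v (Diff t1 t2) = eval v t1 - eval v t2.
Proof. by rewrite /= rmorphN1 mulN1r. Qed.

End Eval.

(** * Rational affine functions and the pieces of a term *)

Notation affine I := ({ffun I -> rat} * rat)%type.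

Section Affine.
Variables (R : realType) (I : finType).
Implicit Types (v : I -> R) (t : pl_term I) (a b : affine I).

Definition affine_at v a : R := \sum_i ratr (a.1 i) * v i + ratr a.2.

Definition scale_affine (q : rat) a : affine I :=
  ([ffun i => q * a.1 i], q * a.2).

Lemma affine_at_const v q : affine_at v (0, q) = ratr q.
Proof.
by rewrite /affine_at big1 ?add0r // => i _; rewrite ffunE rmorph0 mul0r.
Qed.

Lemma affine_at_var v i : affine_at v ([ffun j => (j == i)%:R], 0) = v i.
Proof.
rewrite /affine_at rmorph0 addr0 (bigD1 i) //= ffunE eqxx rmorph1 mul1r.
rewrite big1 ?addr0 // => j /negbTE ji.
by rewrite ffunE ji rmorph0 mul0r.
Qed.

Lemma affine_atD v a b : affine_at v (a + b) = affine_at v a + affine_at v b.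
Proof.
rewrite /affine_at /= rmorphD addrACA -big_split /=; congr (_ + _).
by apply: eq_bigr => i _; rewrite ffunE rmorphD mulrDl.
Qed.

Lemma affine_atZ v q a : affine_at v (scale_affine q a) = ratr q * affine_at v a.
Proof.
rewrite /affine_at /= rmorphM mulrDr mulr_sumr; congr (_ + _).
by apply: eq_bigr => i _; rewrite ffunE rmorphM mulrA.
Qed.

Lemma affine_atN v a : affine_at v (- a) = - affine_at v a.
Proof.
by apply/eqP; rewrite -addr_eq0 -affine_atD addNr affine_at_const rmorph0.
Qed.

Definition term_of_affine a : pl_term I :=
  Add (\big[@Add I/Const 0]_i Scale (a.1 i) (Var i)) (Const a.2).

Lemma eval_term_of_affine v a : eval v (term_of_affine a) = affine_at v a.
Proof.
rewrite /= (big_morph (eval v) (id1 := 0) (op1 := +%R)) //=.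
by rewrite rmorph0.
Qed.

(** A maximum of two pieces splits along the hyperplane where they agree; this
    is the only constructor that creates inequalities. The inequalities are not
    strict, so that the pieces are closed, and they may overlap. *)
Fixpoint term_pieces t : seq (seq (affine I) * affine I) :=
  match t with
  | Const q => [:: ([::], (0, q))]
  | Var i => [:: ([::], ([ffun j => (j == i)%:R], 0))]
  | Add t1 t2 =>
      [seq (p.1 ++ q.1, p.2 + q.2) | p <- term_pieces t1, q <- term_pieces t2]
  | Scale q t1 => [seq (p.1, scale_affine q p.2) | p <- term_pieces t1]
  | Max t1 t2 =>
      [seq (p.2 - q.2 :: p.1 ++ q.1, p.2)
         | p <- term_pieces t1, q <- term_pieces t2] ++
      [seq (q.2 - p.2 :: p.1 ++ q.1, q.2)
         | p <- term_pieces t1, q <- term_pieces t2]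
  end.

Definition satisfies v (c : seq (affine I)) : bool :=
  all (fun a => 0 <= affine_at v a) c.

Lemma satisfies_cat v c d : satisfies v (c ++ d) = satisfies v c && satisfies v d.
Proof. exact: all_cat. Qed.

Lemma term_pieces_cover v t :
  exists2 p, p \in term_pieces t & satisfies v p.1.
Proof.
elim: t => /= [q|i|t1 [p pt1 ps] t2 [q qt2 qs]|q t1 [p pt1 ps]
  |t1 [p pt1 ps] t2 [q qt2 qs]].
- by eexists; first exact: mem_head.
- by eexists; first exact: mem_head.
- exists (p.1 ++ q.1, p.2 + q.2); first exact: allpairs_f.
  by rewrite satisfies_cat ps.
- by exists (p.1, scale_affine q p.2) => //; apply: map_f.
have [pq|/ltW qp] := leP (affine_at v p.2) (affine_at v q.2).
- exists (q.2 - p.2 :: p.1 ++ q.1, q.2) => /=; last first.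
    by rewrite satisfies_cat ps qs affine_atD affine_atN subr_ge0 pq.
  by rewrite mem_cat; apply/orP; right; apply/allpairsP; exists (p, q).
- exists (p.2 - q.2 :: p.1 ++ q.1, p.2) => /=; last first.
    by rewrite satisfies_cat ps qs affine_atD affine_atN subr_ge0 qp.
  by rewrite mem_cat; apply/orP; left; apply/allpairsP; exists (p, q).
Qed.

Lemma eval_piece v t p : p \in term_pieces t -> satisfies v p.1 ->
  eval v t = affine_at v p.2.
Proof.
elim: t p => /= [q|i|t1 IH1 t2 IH2|q t1 IH1|t1 IH1 t2 IH2] p.
- by rewrite inE => /eqP-> _; rewrite affine_at_const.
- by rewrite inE => /eqP-> _; rewrite affine_at_var.
- case/allpairsP => -[p1 p2] /= [/IH1 e1 /IH2 e2 ->] /=.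
  by rewrite satisfies_cat affine_atD => /andP[/e1 -> /e2 ->].
- by case/mapP => p1 /IH1 e1 -> /= /e1 ->; rewrite affine_atZ.
- rewrite mem_cat => /orP[] /allpairsP[[p1 p2] /= [/IH1 e1 /IH2 e2 ->]] /=;
  rewrite satisfies_cat affine_atD affine_atN subr_ge0;
  move=> /and3P[le12 /e1 -> /e2 ->].
    exact/max_idPl.
  exact/max_idPr.
Qed.

End Affine.

(** * Optimizing one variable *)

(** Betweenness as a statement on half-lines: the half-lines containing [e] and
    [w] contain [u]. All inequalities on [u] that are used below are instances
    of it, and it treats [e < w] and [w < e] alike. *)
Definition between (R : realType) (e w u : R) : Prop :=
  forall a b : R, 0 <= a * e + b -> 0 <= a * w + b -> 0 <= a * u + b.

(** Walking from [e] towards [w], one meets the set of solutions of [cs] either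
    at once or at the root of one of the constraints. *)
Lemma exists_breakpoint (R : realType) (cs : seq (R * R)) (e w : R) :
  all (fun c => 0 <= c.1 * w + c.2) cs ->
  exists u, [/\ between e w u, all (fun c => 0 <= c.1 * u + c.2) cs
    & (u == e) || has (fun c => (c.1 != 0) && (u == - c.2 / c.1)) cs].
Proof.
elim: cs => [_|[a b] cs IH /= /andP[abw csw]].
  by exists e; split; rewrite // ?eqxx.
have [u [ewu csu uin]] := IH csw.
have [abu|abu] := leP 0 (a * u + b).
  by exists u; split; rewrite ?csu ?abu // orbCA uin orbT.
(* The constraint fails at [u] and holds at [w]: its root separates them. *)
have d_gt0 : 0 < (a * w + b) - (a * u + b) by lra.
have a_neq0 : a != 0 by apply: contraTneq d_gt0 => ->; rewrite !mul0r subrr ltxx.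
set r := - b / a.
have bE : b = - (a * r) by rewrite /r mulrC divfK // opprK.
have uwr : between u w r.
  move=> c d cu cw; rewrite -(pmulr_rge0 _ d_gt0).
  have -> : (a * w + b - (a * u + b)) * (c * r + d) =
      (a * w + b) * (c * u + d) + - (a * u + b) * (c * w + d).
    by rewrite bE; ring.
  by rewrite addr_ge0 // mulr_ge0 // oppr_ge0 ltW.
exists r; split; last by rewrite a_neq0 eqxx orbT.
- by move=> c d ce cw; apply: uwr => //; apply: ewu.
- rewrite /= bE subrr lexx /=; apply/allP => c cin.
  by apply: uwr; [exact: (allP csu)|exact: (allP csw)].
Qed.

Section Optimize.
Variables (R : realType) (I : finType).
Implicit Types (v : I -> R) (t : pl_term (option I)) (a : affine (option I)).

Definition rest_affine a : affine I := ([ffun i => a.1 (Some i)], a.2).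

Lemma big_option (F : option I -> R) :
  \sum_o F o = F None + \sum_i F (Some i).
Proof.
rewrite (bigD1 None) //=; congr (_ + _).
rewrite (reindex_omap Some id) /=; last by case.
by apply: eq_bigl => i; rewrite eqxx.
Qed.

Lemma affine_at_oapp v w a :
  affine_at (oapp v w) a = ratr (a.1 None) * w + affine_at v (rest_affine a).
Proof.
rewrite /affine_at big_option /= addrA; congr (_ + _ + _).
by apply: eq_bigr => i _; rewrite ffunE.
Qed.

(** The value of the last variable at which [a] vanishes. If that variable does
    not occur in [a], the inverse is 0 and so is the breakpoint, which is then a
    harmless extra candidate. *)
Definition breakpoint a : affine I :=
  scale_affine (- (a.1 None)^-1) (rest_affine a).

Definition inst t (u : pl_term I) : pl_term I := subst (oapp (@Var I) u) t.

Lemma eval_inst v t u : eval v (inst t u) = eval (oapp v (eval v u)) t.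
Proof. by rewrite eval_subst; apply: eq_eval; case. Qed.

Definition clamp (hi u : pl_term I) : pl_term I := Max (Const 0) (Min u hi).

Lemma eval_clamp v hi u :
  eval v (clamp hi u) = Num.max 0 (Num.min (eval v u) (eval v hi)).
Proof. by rewrite -eval_Min /= rmorph0. Qed.

Definition breakpoints t : seq (affine I) :=
  [seq breakpoint a | p <- term_pieces t, a <- p.1].

Definition candidates (hi : pl_term I) t : seq (pl_term I) :=
  hi :: Const 0 :: [seq clamp hi (term_of_affine b) | b <- breakpoints t].

(** Taking [s] to be 1 or -1 gives minimization or maximization. The point
    [w] is moved inside a piece that contains it, where the term is affine,
    until it meets an end of the interval or a breakpoint. *)
Lemma exists_candidate v t hi (s w : R) : 0 <= w <= eval v hi ->
  exists2 u, u \in [seq eval v c | c <- candidates hi t] &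
     s * eval (oapp v u) t <= s * eval (oapp v w) t.
Proof.
case/andP => w0 wh.
have [[c a] pin psat] := term_pieces_cover (oapp v w) t.
have ev u : satisfies (oapp v u) c ->
    eval (oapp v u) t = ratr (a.1 None) * u + affine_at v (rest_affine a).
  by move=> us; rewrite (eval_piece pin us) affine_at_oapp.
move: (ratr (a.1 None) : R) ev => k ev.
(* The end of the interval at which [s] times the affine value is smallest. *)
pose e := if 0 <= s * k then 0 else eval v hi.
pose cs := [seq (ratr (h.1 None) : R, affine_at v (rest_affine h))
    | h : affine (option I) <- c].
have csE u : satisfies (oapp v u) c = all (fun c => 0 <= c.1 * u + c.2) cs.
  by rewrite /cs all_map; apply: eq_all => h /=; rewrite affine_at_oapp.
have : all (fun c => 0 <= c.1 * w + c.2) cs by rewrite -csE.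
case/(exists_breakpoint e) => u [ewu ucs uin].
have hi0 : 0 <= eval v hi := le_trans w0 wh.
(* Half-lines containing both [e] and [w] contain [u]. *)
have u0 : 0 <= u.
  have := ewu 1 0; rewrite !mul1r !addr0; apply => //.
  by rewrite /e; case: ifP.
have uh : u <= eval v hi.
  have := ewu (- 1) (eval v hi); rewrite !mulN1r !(addrC (- _)) !subr_ge0.
  by apply => //; rewrite /e; case: ifP.
exists u.
- rewrite /= !inE rmorph0; case/orP: uin => [/eqP->|].
    by rewrite /e; case: ifP; rewrite eqxx ?orbT.
  case/hasP => _ /mapP[h hc ->] /= /andP[h0 /eqP uE].
  apply/orP; right; apply/orP; right; rewrite -map_comp.
  apply/mapP; exists (breakpoint h).
    by apply/allpairsPdep; exists (c, a), h.
  change (u = eval v (clamp hi (term_of_affine (breakpoint h)))).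
  rewrite eval_clamp eval_term_of_affine affine_atZ.
  rewrite rmorphN fmorphV mulNr mulrC -mulNr -uE.
  by rewrite (min_idPl uh) (max_idPr u0).
(* The half-line bounded by [w] in the direction of [e] contains [u]. *)
- rewrite !ev // ?csE //; have := ewu (- (s * k)) (s * k * w).
  rewrite !mulNr !(addrC (- _)) subrr lexx => /(_ _ isT) h.
  rewrite !mulrDr lerD2r !mulrA -subr_ge0; apply: h.
  rewrite -mulrBr /e; case: ifP => [sk|/negbT]; first by rewrite subr0 mulr_ge0.
  by rewrite -ltNge => /ltW sk; rewrite mulr_le0 // subr_le0.
Qed.

Definition best (p : player) : R -> R -> R :=
  if p is EdgeHitter then Num.min else Num.max.

Definition best_term (p : player) (J : Type) : pl_term J -> pl_term J -> pl_term J :=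
  if p is EdgeHitter then @Min J else @Max J.

Definition optimum_term (p : player) (hi : pl_term I) t : pl_term I :=
  \big[@best_term p I/inst t hi]_(c <- candidates hi t) inst t c.

Lemma eval_optimum_term p v hi t :
  eval v (optimum_term p hi t) =
  \big[best p/eval v (inst t hi)]_(c <- candidates hi t) eval v (inst t c).
Proof.
by apply: big_morph => // t1 t2; case: p => //=; rewrite -eval_Min.
Qed.

(** Multiplying by the sense turns both optimization problems into minima. *)
Definition sense (p : player) : R := if p is EdgeHitter then 1 else -1.

Lemma is_optimumE p (A : set R) y :
  is_optimum p A y <-> A y /\ forall z, A z -> sense p * y <= sense p * z.
Proof.
by split=> -[Ay opt]; split=> //; case: p opt => opt z /opt;
  rewrite /= ?mul1r ?mulN1r ?lerN2.
Qed.

Lemma best_seqP p (y : R) (s : seq R) : y \in s ->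
  let m := \big[best p/y]_(z <- s) z in
  m \in s /\ forall z, z \in s -> sense p * m <= sense p * z.
Proof.
move=> ys /=.
(* The default value [y] is an element of [s], hence it is not an exception. *)
suff: \big[best p/y]_(z <- s) z \in y :: s /\
    forall z, z \in s -> sense p * \big[best p/y]_(z <- s) z <= sense p * z.
  by case; rewrite inE => /predU1P[->|].
elim: s {ys} => [|x s [IHin IHopt]]; first by rewrite big_nil inE eqxx.
rewrite big_cons; set m := \big[_/_]_(_ <- _) _ in IHin IHopt *.
have [bx bm] : sense p * best p x m <= sense p * x /\
    sense p * best p x m <= sense p * m.
  by case: p {m IHin IHopt} (m) => /= m;
    rewrite ?mul1r ?mulN1r ?lerN2 ?ge_min ?le_max ?lexx ?orbT.
split=> [|z]; last first.
  by rewrite inE => /predU1P[-> //|/IHopt]; exact: le_trans.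
have : best p x m = x \/ best p x m = m.
  case: p {IHin IHopt bx bm} m => m /=.
    by rewrite minEle; case: ifP; [left|right].
  by rewrite maxEle; case: ifP; [right|left].
case=> ->; first by rewrite !inE eqxx orbT.
by move: IHin; rewrite !inE => /orP[->|->]; rewrite ?orbT.
Qed.

Lemma candidate_bounds v t hi (u : R) : 0 <= eval v hi ->
  u \in [seq eval v c | c <- candidates hi t] -> 0 <= u <= eval v hi.
Proof.
move=> hi0; rewrite /candidates !map_cons !inE -map_comp.
case/or3P=> [/eqP->|/eqP->|/mapP[b _ ->]].
- by rewrite hi0 lexx.
- by rewrite /= rmorph0 lexx.
- change (0 <= eval v (clamp hi (term_of_affine b)) <= eval v hi).
  by rewrite eval_clamp le_max lexx ge_max hi0 ge_min lexx orbT.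
Qed.

(** The candidates are feasible, and each feasible choice is matched by a
    candidate, so the best candidate is an optimum over the interval. *)
Lemma optimum_termP p v hi t : 0 <= eval v hi ->
  is_optimum p
    [set eval (oapp v w) t | w in [set w | 0 <= w <= eval v hi]]
    (eval v (optimum_term p hi t)).
Proof.
move=> hi0; apply/is_optimumE.
pose f u := eval (oapp v u) t.
pose us := [seq eval v c | c <- candidates hi t].
have hius : f (eval v hi) \in map f us by apply/map_f/mem_head.
have -> : eval v (optimum_term p hi t) = \big[best p/f (eval v hi)]_(z <- map f us) z.
  rewrite eval_optimum_term eval_inst !big_map; apply: eq_bigr => c _.
  exact: eval_inst.
have [/mapP[u uin ->] opt] := best_seqP p hius.
split=> [|_ [w whi <-]].
  by exists u => //; apply: candidate_bounds uin.
have [u' u'in le_u'w] := exists_candidate t (sense p) whi.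
exact: le_trans (opt _ (map_f f u'in)) le_u'w.
Qed.

End Optimize.

(** * The backward recursion on terms *)

Section Game.
Variables (R : realType) (n : nat) (H : hypergraph n).
Notation m := #|edge H|.
Implicit Types (x : load R H) (r w : R) (p : state R H).
Implicit Types (i : 'I_n) (s : pl_term (option 'I_m)).

(** Variables [Some k] are the loads and [None] is the remaining budget. In the
    terms below a further [option] adds the weight of the next submove. *)
Definition coords p : option 'I_m -> R := oapp (p.1 ord0) p.2.

Definition wmax_term i : pl_term (option 'I_m) :=
  Min (Var None) (\big[@Max (option 'I_m)/Const 0]_(e : edge H | i \in val e)
    Diff (Const 1) (Var (Some (enum_rank e)))).

Lemma eval_wmax_term i x r : eval (coords (x, r)) (wmax_term i) = wmax i x r.
Proof.
rewrite eval_Min; congr Num.min.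
rewrite (big_morph (eval _) (id1 := 0) (op1 := Num.max)) //; last by rewrite /= rmorph0.
by apply: eq_bigr => e _; rewrite eval_Diff /= rmorph1.
Qed.

(** The duration from a submove for [i] on, as a function of the state and of
    the weight of the submove, if [s] is the duration after it. *)
Definition play_term i (budget : pl_term (option (option 'I_m))) s :
    pl_term (option (option 'I_m)) :=
  Add (Var None) (subst (oapp (fun k : 'I_m =>
    if i \in val (enum_val k : edge H)
    then Min (Const 1) (Add (Var (Some (Some k))) (Var None))
    else Var (Some (Some k))) budget) s).

Lemma eval_play_term i budget s x r w :
  let v := oapp (coords (x, r)) w in
  eval v (play_term i budget s) =
  w + eval (coords (update i x w, eval v budget)) s.
Proof.
move=> v; rewrite /= eval_subst; congr (_ + _); apply: eq_eval => -[k|] //=.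
by rewrite mxE; case: ifP => // _; rewrite eval_Min /= rmorph1.
Qed.

Definition budget_left : pl_term (option (option 'I_m)) :=
  Diff (Var (Some None)) (Var None).

Definition backward_term (pl : player) (free last : bool) i s :
    pl_term (option 'I_m) :=
  if free then optimum_term pl (wmax_term i) (play_term i budget_left s)
  else inst (play_term i (if last then Const 1 else budget_left) s) (wmax_term i).

Lemma wmax_bounds i x r : domain R H (x, r) -> 0 <= wmax i x r <= r.
Proof.
case=> _ /= /andP[r0 _]; rewrite /wmax le_min r0 /= ge_min lexx andbT.
exact: bigmax_ge_id.
Qed.

Lemma update_domain i x r w r' : domain R H (x, r) -> 0 <= w -> 0 <= r' <= 1 ->
  domain R H (update i x w, r').
Proof.
move=> [/= x01 _] w0 r'01; split=> // e; rewrite /load_at mxE enum_rankK.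
have /andP[x0 x1] := x01 e; case: ifP => _; last exact: x01.
by rewrite le_min ler01 ge_min lexx addr_ge0.
Qed.

Lemma is_optimum_unique (pl : player) (A : set R) y z :
  is_optimum pl A y -> is_optimum pl A z -> y = z.
Proof.
move=> /is_optimumE[Ay oy] /is_optimumE[Az oz].
have : sense R pl * y = sense R pl * z by apply/le_anti; rewrite oy ?oz.
by case: pl {oy oz}; rewrite /= ?mul1r ?mulN1r // => /oppr_inj.
Qed.

(** One step of the recursion, read both ways: the value given by the term
    satisfies the defining condition, and nothing else does. For free submoves
    the converse holds because an optimum is unique. *)
Lemma backward_termP (pl : player) (free last : bool) i s
    (Tj : state R H -> R) x r y :
  (forall p, domain R H p -> Tj p = eval (coords p) s) ->
  domain R H (x, r) ->
  (if free then is_optimum pl (free_outcomes i Tj x r) y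
   else if last then y = wmax i x r + Tj (update i x (wmax i x r), 1)
   else y = wmax i x r + Tj (update i x (wmax i x r), r - wmax i x r))
  <-> y = eval (coords (x, r)) (backward_term pl free last i s).
Proof.
move=> Tjs dom; have /andP[w0 wr] := wmax_bounds i dom.
have r1 : r <= 1 by case: dom => _ /= /andP[].
have left w : 0 <= w <= wmax i x r -> w + Tj (update i x w, r - w) =
    eval (oapp (coords (x, r)) w) (play_term i budget_left s).
  case/andP => w0' ww; rewrite eval_play_term eval_Diff /= Tjs //.
  apply: (update_domain _ dom) => //.
  by rewrite subr_ge0 (le_trans ww wr) lerBlDr (le_trans r1) // lerDl.
rewrite /backward_term; case: free.
  have -> : free_outcomes i Tj x r =
      [set eval (oapp (coords (x, r)) w) (play_term i budget_left s)
        | w in [set w | 0 <= w <= wmax i x r]].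
    by apply: eq_imagel => w; exact: left.
  have hi0 : 0 <= eval (coords (x, r)) (wmax_term i) by rewrite eval_wmax_term.
  have := optimum_termP pl (play_term i budget_left s) hi0.
  rewrite eval_wmax_term => opt.
  by split=> [/is_optimum_unique|->//]; exact.
rewrite eval_inst eval_wmax_term; case: last.
  rewrite eval_play_term /= rmorph1 Tjs //.
  by apply: (update_domain _ dom) => //; rewrite ler01 lexx.
by rewrite left // w0 lexx.
Qed.

(** * Remaining durations are terms *)

Definition submove := ('I_n * 'I_n.+1 * 'I_n)%type.

Definition submove_index (u : submove) : nat :=
  u.1.1 * (n ^ 2 + n) + u.1.2 * n + u.2.

(** The index has the move, the round and the vertex as its digits in the mixed
    radix [n], [n.+1], [n], and successive divisions recover them. *)
Lemma submove_index_inj : injective submove_index.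
Proof.
move=> [[a b] c] [[a' b'] c']; rewrite /submove_index /=.
have E (x y z : nat) : (x * (n ^ 2 + n) + y * n + z = (x * n.+1 + y) * n + z)%N.
  by rewrite expnS expn1; lia.
rewrite !E => e; have n0 : (0 < n)%N := leq_ltn_trans (leq0n c) (ltn_ord c).
have ec : c = c' :> nat.
  by have := congr1 (modn^~ n) e; rewrite /= !modnMDl !modn_small.
have := congr1 (divn^~ n) e; rewrite /= !divnMDl // !divn_small // !addn0 => eab.
have eb : b = b' :> nat.
  by have := congr1 (modn^~ n.+1) eab; rewrite /= !modnMDl !modn_small.
have ea : a = a' :> nat.
  by have := congr1 (divn^~ n.+1) eab; rewrite /= !divnMDl // !divn_small // !addn0.
by rewrite (val_inj ea) (val_inj eb) (val_inj ec).
Qed.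

Lemma submove_index_lt u : (submove_index u < num_submoves n)%N.
Proof.
case: u => -[a b] c; rewrite /submove_index /num_submoves /= expnS expn1.
have := ltn_ord a; have := ltn_ord b; have := ltn_ord c; nia.
Qed.

Lemma submove_index_onto k : (k < num_submoves n)%N ->
  exists u, submove_index u = k.
Proof.
move=> kN.
pose f u : 'I_(num_submoves n) := Ordinal (submove_index_lt u).
have f_inj : injective f by move=> u u' [/submove_index_inj].
have /codomP[u ku] : Ordinal kN \in codom f.
  apply: inj_card_onto => //.
  by rewrite !card_prod !card_ord /num_submoves expnS expn1; lia.
by exists u; case: ku.
Qed.

(** [k] is the number of submoves still to be made. By
    [submove_index_onto] and [submove_index_inj], the next of them is found by
    [pick] and is determined, for [0 < k <= num_submoves n]. *)
Fixpoint duration_term (first : player) (k : nat) : pl_term (option 'I_m) :=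
  if k is k'.+1 then
    if [pick u | submove_index u == (num_submoves n - k)%N] is Some u then
      backward_term (mover first u.1.1) (u.1.2 < n)%N
        (n ^ 2 + n %| (submove_index u).+1)%N u.2 (duration_term first k')
    else Const 0
  else Const 0.

Lemma duration_term_submove first u :
  duration_term first (num_submoves n - submove_index u) =
  backward_term (mover first u.1.1) (u.1.2 < n)%N
    (n ^ 2 + n %| (submove_index u).+1)%N u.2
    (duration_term first (num_submoves n - (submove_index u).+1)).
Proof.
have uN := submove_index_lt u.
have kE : (num_submoves n - submove_index u = (num_submoves n - (submove_index u).+1).+1)%N.
  by rewrite subnSK.
rewrite {1}kE [LHS]/= -kE subKn ?(ltnW uN) //.
case: pickP => [u' /eqP /submove_index_inj->//|/(_ u)].
by rewrite eqxx.
Qed.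

Lemma remaining_duration_exists first :
  exists T : nat -> state R H -> R, remaining_duration first T.
Proof.
pose T j p := eval (coords p) (duration_term first (num_submoves n - j)).
exists T; split=> [x r _|a b c x r dom]; first by rewrite /T subnn /= rmorph0.
have [_] := backward_termP (mover first a) (b < n)%N
  (n ^ 2 + n %| (submove_index (a, b, c)).+1)%N c
  (T (submove_index (a, b, c)) (x, r))
  (fun p _ => erefl (T (submove_index (a, b, c)).+1 p)) dom.
by apply; rewrite /T duration_term_submove.
Qed.

Lemma remaining_duration_term first (T : nat -> state R H -> R) k :
  remaining_duration first T -> (k <= num_submoves n)%N ->
  forall p, domain R H p ->
    T (num_submoves n - k)%N p = eval (coords p) (duration_term first k).
Proof.
move=> [TN Tj]; elim: k => [_ [x r] dom|k IH kN [x r] dom].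
  by rewrite subn0 TN //= rmorph0.
have [u uE] : exists u, submove_index u = (num_submoves n - k.+1)%N.
  by apply: submove_index_onto; rewrite -subSn // subSS leq_subr.
have kE : k.+1 = (num_submoves n - submove_index u)%N by rewrite uE subKn.
have jE : (num_submoves n - k = (submove_index u).+1)%N by lia.
have kE' : k = (num_submoves n - (submove_index u).+1)%N by lia.
rewrite kE duration_term_submove subKn ?(ltnW (submove_index_lt u)) // -kE'.
have Tk p : domain R H p ->
    T (submove_index u).+1 p = eval (coords p) (duration_term first k).
  by rewrite -jE; apply: IH; exact: ltnW.
have [bw _] := backward_termP (mover first u.1.1) (u.1.2 < n)%N
  (n ^ 2 + n %| (submove_index u).+1)%N u.2 (T (submove_index u) (x, r)) Tk dom.
by apply: bw; exact: (Tj u.1.1 u.1.2 u.2 x r dom).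
Qed.

End Game.

(** * Topology and rational pieces *)

Section Pieces.
Variables (R : realType) (n : nat) (H : hypergraph n).
Notation m := #|edge H|.

Lemma continuous_eval (t : pl_term (option 'I_m)) :
  continuous (fun p : state R H => eval (coords p) t : R^o).
Proof.
elim: t => [q|[k|]|t1 IH1 t2 IH2|q t IH|t1 IH1 t2 IH2] p /=.
- exact: cvg_cst.
- apply: (@continuous_comp _ _ _ fst (fun x : load R H => x ord0 k)).
    exact: cvg_fst.
  exact: coord_continuous.
- exact: cvg_snd.
- by apply: cvgD; [exact: IH1|exact: IH2].
- by apply: cvgM; [exact: cvg_cst|exact: IH].
- by apply: (@continuous_max _ _ _ _ p); [exact: IH1|exact: IH2].
Qed.

Definition to_rat_affine (a : affine (option 'I_m)) : rat_affine H :=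
  (\row_k a.1 (Some k), a.1 None, a.2).

Lemma affine_eval_to_rat a (p : state R H) :
  affine_eval (to_rat_affine a) p = affine_at (coords p) a.
Proof.
rewrite /affine_eval /affine_at big_option /= [RHS]addrAC [in RHS]addrC addrA.
by congr (_ + _ + _); apply: eq_bigr => k _; rewrite mxE.
Qed.

Definition rat_pieces (t : pl_term (option 'I_m)) : seq (rat_piece H) :=
  [seq (map to_rat_affine q.1, to_rat_affine q.2) | q <- term_pieces t].

Lemma rat_polyhedron_map c (p : state R H) :
  rat_polyhedron (map to_rat_affine c) p <-> satisfies (coords p) c.
Proof.
split=> [h|/allP h _ /mapP[a /h a0 ->]]; last by rewrite affine_eval_to_rat.
by apply/allP => a ac; rewrite -affine_eval_to_rat; apply/h/map_f.
Qed.

Lemma piecewise_by_rat_pieces (f : state R H -> R) t :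
  (forall p, domain R H p -> f p = eval (coords p) t) ->
  piecewise_by f (rat_pieces t).
Proof.
move=> ft; split=> [p _|_ p /mapP[q qt ->] dom /rat_polyhedron_map qp].
  have [q qt /rat_polyhedron_map qp] := term_pieces_cover (coords p) t.
  by exists (map to_rat_affine q.1, to_rat_affine q.2) => //; apply: map_f.
by rewrite ft // affine_eval_to_rat; exact: eval_piece qp.
Qed.

Lemma continuous_affine_eval (a : rat_affine H) :
  continuous (affine_eval a : state R H -> R^o).
Proof.
case: a => -[c d] k.
pose a : affine (option 'I_m) := ([ffun o => oapp (c ord0) d o], k).
suff -> : affine_eval (c, d, k) = (fun p : state R H => eval (coords p) (term_of_affine a)).
  exact: continuous_eval.
apply/funext => p; rewrite eval_term_of_affine -affine_eval_to_rat.
congr (affine_eval (_, _, _) p); last by rewrite ffunE.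
by apply/rowP => j; rewrite mxE ffunE.
Qed.

Lemma closed_nonneg (f : state R H -> R^o) :
  continuous f -> closed [set p | 0 <= f p].
Proof.
move=> fc; apply: (@preimage_closed _ _ f [set y : R^o | 0 <= y]).
  by move=> x _; exact: fc.
exact: closed_ge.
Qed.

Lemma closed_rat_polyhedron (c : seq (rat_affine H)) :
  closed (rat_polyhedron c : set (state R H)).
Proof.
rewrite (_ : rat_polyhedron c =
    \bigcap_(h in [set` c]) [set p : state R H | 0 <= affine_eval h p]).
  by apply: closed_bigI => h _; exact/closed_nonneg/continuous_affine_eval.
by [].
Qed.

Lemma closed_domain : closed (domain R H).
Proof.
(* The domain is given by inequalities between values of terms. *)
pose V o := @Var (option 'I_m) o.
rewrite (_ : domain R H = \bigcap_(o in [set: option 'I_m])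
    ([set p : state R H | 0 <= eval (coords p) (V o)] `&`
     [set p : state R H | 0 <= eval (coords p) (Diff (Const 1) (V o))])).
  apply: closed_bigI => o _; apply: closedI;
    exact/closed_nonneg/continuous_eval.
apply/seteqP; split=> p.
  case=> x01 r01 o _.
  have : 0 <= coords p o <= 1.
    case: o => [k|//].
    by have := x01 (enum_val k); rewrite /load_at enum_valK.
  by case/andP=> o0 o1; split; rewrite /mkset ?eval_Diff //= rmorph1 subr_ge0.
move=> p01; have {}p01 o : 0 <= coords p o <= 1.
  have [/= p0] := p01 o I.
  by rewrite p0 rmorph1 rmorphN1 mulN1r subr_ge0.
by split=> [e|]; [exact: (p01 (Some (enum_rank e)))|exact: (p01 None)].
Qed.

Lemma closed_region (pieces : seq (rat_piece H)) a :
  closed (region pieces a : set (state R H)).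
Proof.
rewrite (_ : region pieces a = domain R H `&`
    \bigcup_(q in [set` [seq q <- pieces | q.2 == a]]) rat_polyhedron q.1).
  apply: closedI; first exact: closed_domain.
  apply: closed_bigcup => [|q _]; first exact: finite_seq.
  exact: closed_rat_polyhedron.
apply/seteqP; split=> p [dom [q]] /=.
  by move=> qp [/eqP qa qpoly]; split=> //; exists q => //=; rewrite mem_filter qa.
by rewrite mem_filter => /andP[/eqP qa qp] qpoly; split=> //; exists q.
Qed.

(** Since regions are closed, a boundary is an intersection of two regions, and
    it is cut out by pairs of polyhedra, one from each region. It lies on the
    hyperplane [a = b] because both functions equal [f] there. *)
Lemma rational_boundaries_of_piecewise (f : state R H -> R)
    (pieces : seq (rat_piece H)) :
  piecewise_by f pieces -> rational_boundaries R pieces.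
Proof.
move=> [_ fE] a b _ _ _.
exists [seq q.1 ++ q'.1 | q <- [seq q <- pieces | q.2 == a],
                          q' <- [seq q <- pieces | q.2 == b]].
rewrite /boundary -!(closure_id _).1; [|exact: closed_region..].
apply/seteqP; split=> p.
  move=> [[dom [q qin [qa qp]]] [_ [q' q'in [q'b q'p]]]]; split=> //.
    by rewrite -qa -q'b -!fE.
  exists (q.1 ++ q'.1).
    by apply: allpairs_f; rewrite mem_filter ?qa ?q'b eqxx.
  by move=> h; rewrite mem_cat => /orP[/qp|/q'p].
case=> dom _ [c /allpairsP[[q q'] /= [+ + ->]] qq'].
rewrite !mem_filter => /andP[/eqP qa qin] /andP[/eqP q'b q'in].
split; split=> //; [exists q => //|exists q' => //]; split=> // h hin;
  by apply: qq'; rewrite mem_cat hin ?orbT.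
Qed.

End Pieces.

Theorem theorem11 (R : realType) (n : nat) (H : hypergraph n)
    (first : player) :
  (exists T : nat -> state R H -> R, remaining_duration first T) /\
  (forall T : nat -> state R H -> R, remaining_duration first T ->
   forall j : nat, (j <= n ^ 3 + n ^ 2)%N ->
   {within domain R H, continuous (T j)} /\
   exists pieces : seq (rat_piece H),
     piecewise_by (T j) pieces /\ rational_boundaries R pieces).
Proof.
split=> [|T TH j jN]; first exact: remaining_duration_exists.
have {}jN : (j <= num_submoves n)%N.
  by apply: leq_trans jN _; rewrite /num_submoves !expnS expn0; nia.
pose t := duration_term H first (num_submoves n - j).
have Tt p : domain R H p -> T j p = eval (coords p) t.
  move=> dom; rewrite -[j in LHS](subKn jN).
  by apply: remaining_duration_term dom => //; exact: leq_subr.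
have pw := piecewise_by_rat_pieces Tt.
split; last by exists (rat_pieces t); split=> //; exact: rational_boundaries_of_piecewise pw.
apply: (@subspace_eq_continuous _ _ _ (fun p => eval (coords p) t : R^o)).
  by move=> p /set_mem dom; exact/esym/Tt.
exact/continuous_subspaceT/continuous_eval.
Qed.
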